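(* Let $\Psi=|\psi_1,\dots,\psi_N\rangle$ be a Slater determinant whose orbitals $\psi_i$ are orthonormal and lie in $\mathrm{Span}\{\varphi_1,\dots,\varphi_L\}$, with coefficient matrix $U=(u_1\,\cdots\,u_L)\in\mathbb{R}^{N\times L}$, $UU^T=\mathrm{Id}_N$, and occupation tensor $\hat\Psi=(\hat\Psi_{\mu_1\dots\mu_L})$. Let $1\le k\le L-1$, and let $V_k=(u_1\,\cdots\,u_k)\in\mathbb{R}^{N\times k}$ and $W_k=(u_{k+1}\,\cdots\,u_L)\in\mathbb{R}^{N\times(L-k)}$, so that $U=(V_k\ W_k)$. Assume that $V_k$ and $W_k$ are full-rank matrices. Let $\sigma_1\ge\dots\ge\sigma_d$ be the nonzero singular values of the matrix reshape $\hat\Psi^{\mu_1,\dots,\mu_k}_{\mu_{k+1},\dots,\mu_L}$. Then there are exactly $d=\min(2^k,2^N,2^{L-k})$ nonzero singular values. Moreover these singular values satisfy $$\forall\,1\le j\le d,\qquad \sigma_j^2\,\sigma_{d+1-j}^2=p(k,L,N)$$ for some $j$-independent constant $p(k,L,N)$. Explicitly, $$p(k,L,N)=\begin{cases}\det(V_k^TV_k)\det(W_kW_k^T), & \text{if } k\le N,\\ \det(V_kV_k^T)\det(W_kW_k^T), & \text{if } N\le k\le L-N,\\ \det(V_kV_k^T)\det(W_k^TW_k), & \text{if } L-N\le k\le L-1.\end{cases}$$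
   Context: Fix a single-particle basis $\{\varphi_1,\dots,\varphi_L\}$, i.e. an $L^2$-orthonormal set of functions in $H^1(\mathbb{R}^3\times\{\pm\frac12\})$. For orthonormal $\psi_1,\dots,\psi_N\in\mathrm{Span}\{\varphi_1,\dots,\varphi_L\}$ the Slater determinant is the function $|\psi_1,\dots,\psi_N\rangle(x_1,\dots,x_N)=\frac1{\sqrt{N!}}\det(\psi_i(x_j))_{i,j=1}^N$, $x_j\in\mathbb{R}^3\times\{\pm\frac12\}$. Write $\psi_i=\sum_{j=1}^L U_{ij}\varphi_j$ with real coefficients; then $U\in\mathbb{R}^{N\times L}$ satisfies $UU^T=\mathrm{Id}_N$, and its columns are denoted $u_1,\dots,u_L\in\mathbb{R}^N$. Occupation tensor (occupation representation): expanding $\Psi=\sum_{1\le i_1<\dots<i_N\le L}c_{i_1\dots i_N}|\varphi_{i_1},\dots,\varphi_{i_N}\rangle$, the tensor $\hat\Psi=(\hat\Psi_{\mu_1\dots\mu_L})_{\mu\in\{0,1\}^L}$ is defined by $\hat\Psi_{\mu_1\dots\mu_L}=0$ if $\sum_i\mu_i\ne N$, and $\hat\Psi_{\mu_1\dots\mu_L}=c_{i_1\dots i_N}$ if $i_1<\dots<i_N$ are exactly the indices with $\mu_i=1$. Explicitly, for a Slater determinant, $c_{i_1\dots i_N}=\det(u_{i_1}\,\cdots\,u_{i_N})$. The matrix reshape $\hat\Psi^{\mu_1,\dots,\mu_k}_{\mu_{k+1},\dots,\mu_L}$ is the $2^k\times 2^{L-k}$ matrix with rows indexed by $(\mu_1,\dots,\mu_k)\in\{0,1\}^k$,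 columns indexed by $(\mu_{k+1},\dots,\mu_L)\in\{0,1\}^{L-k}$, and entries $\hat\Psi_{\mu_1\dots\mu_L}$. Singular values are counted with multiplicity. A matrix is full-rank if its rank equals the smaller of its two dimensions.
   Formalization: Assumes N ≤ k or N ≤ L−k (the count d fails if L−N<k<N, e.g. N=L=2, k=1, U=Id); the first formula for p also requires N ≤ L−k and the third N ≤ k, since otherwise they give 0. All this is automatic when 2N ≤ L. *)

(* Defs.v *)
From HB Require Import structures.
From mathcomp Require Import all_boot all_order all_algebra.
From mathcomp Require Import all_classical all_reals all_analysis.
From mathcomp Require Import polyrcf complex.

Set Implicit Arguments.
Unset Strict Implicit.
Unset Printing Implicit Defensive.

Import Order.TTheory GRing.Theory Num.Theory.
Import numFieldNormedType.Exports.

Local Open Scope ring_scope.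

Section SingleParticle.
Context {R : realType}.

(* Spin values +1/2 and -1/2 are encoded by bool. *)
Definition spin_space : Type := ((R * R * R) * bool)%type.

Local Notation lebesgue3 :=
  ((@lebesgue_measure R \x @lebesgue_measure R) \x @lebesgue_measure R)%E
  (only parsing).

Definition int3 (u : R * R * R -> R) : R := \int[lebesgue3]_r u r.

Definition L2_R3 (u : R * R * R -> R) : Prop :=
  measurable_fun setT u /\
  lebesgue3.-integrable setT (fun r => (u r ^+ 2)%:E).

Definition axis (a : 'I_3) : R * R * R :=
  ((val a == 0%N)%:R, (val a == 1%N)%:R, (val a == 2%N)%:R).

Definition partial (a : 'I_3) (u : R * R * R -> R) : R * R * R -> R :=
  fun r => 'D_(axis a) u r.

Definition smooth (u : R * R * R -> R) : Prop :=
  forall s : seq 'I_3,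
    continuous (foldr partial u s) /\
    forall a r, derivable (foldr partial u s) r (axis a).

Definition test_function (u : R * R * R -> R) : Prop :=
  smooth u /\
  exists2 K : set (R * R * R), compact K & forall r, ~ K r -> u r = 0.

Definition weak_partial (a : 'I_3) (u v : R * R * R -> R) : Prop :=
  forall chi, test_function chi ->
    int3 (fun r => u r * partial a chi r) = - int3 (fun r => v r * chi r).

Definition H1_R3 (u : R * R * R -> R) : Prop :=
  L2_R3 u /\
  forall a, exists2 v : R * R * R -> R, L2_R3 v & weak_partial a u v.

(* Functions are complex-valued; real-valued ones are those with zero
   imaginary part. *)
Definition H1 (f : spin_space -> R[i]) : Prop :=
  forall s : bool, H1_R3 (fun r => complex.Re (f (r, s))) /\
                   H1_R3 (fun r => complex.Im (f (r, s))).

(* The L^2 inner product, i.e. the integral of (conj f) * g over space summed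
   over the spin, written out in real and imaginary parts. *)
Definition l2_dot (f g : spin_space -> R[i]) : R[i] :=
  Complex
    (\sum_(s : bool) int3 (fun r =>
       complex.Re (f (r, s)) * complex.Re (g (r, s)) +
       complex.Im (f (r, s)) * complex.Im (g (r, s))))
    (\sum_(s : bool) int3 (fun r =>
       complex.Re (f (r, s)) * complex.Im (g (r, s)) -
       complex.Im (f (r, s)) * complex.Re (g (r, s)))).

Definition orthonormal_family n (f : 'I_n -> spin_space -> R[i]) : Prop :=
  forall i j, l2_dot (f i) (f j) = (i == j)%:R.

Definition slater n (f : 'I_n -> spin_space -> R[i])
    (x : 'I_n -> spin_space) : R[i] :=
  (Num.sqrt (n`!%:R : R))^-1%:C%C * \det (\matrix_(i < n, j < n) f i (x j)).

(* i_1 < ... < i_n *)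
Definition increasing n L (I : {ffun 'I_n -> 'I_L}) : bool :=
  [forall a : 'I_n, forall b : 'I_n, (a < b)%N ==> (I a < I b)%N].

Definition occupation n L (I : {ffun 'I_n -> 'I_L}) : {ffun 'I_L -> bool} :=
  [ffun j => j \in codom I].

(* T is the occupation tensor of the N-particle function Psi: it vanishes on
   occupations with particle number other than N, and its other entries are
   the coefficients c_{i_1...i_N} of Psi in the Slater determinants of phi. *)
Definition occupation_tensor N L (phi : 'I_L -> spin_space -> R[i])
    (Psi : ('I_N -> spin_space) -> R[i])
    (T : {ffun 'I_L -> bool} -> R) : Prop :=
  (forall mu : {ffun 'I_L -> bool}, (\sum_i mu i)%N <> N -> T mu = 0) /\
  forall x, Psi x =
    \sum_(I : {ffun 'I_N -> 'I_L} | increasing I)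
       (T (occupation I))%:C%C * slater (fun a => phi (I a)) x.

End SingleParticle.

Section Matrices.
Context {R : realType}.

Definition full_rank m n (A : 'M[R]_(m, n)) : Prop := \rank A = minn m n.

(* The square roots of the positive eigenvalues of A^T A, each repeated
   according to its multiplicity, in nonincreasing order (rootsR lists the
   distinct real roots in increasing order). *)
Definition nonzero_singular_values m n (A : 'M[R]_(m, n)) : seq R :=
  let p := char_poly (A^T *m A) in
  [seq Num.sqrt x |
    x <- flatten [seq nseq (mup x p) x | x <- rev (rootsR p)] & 0 < x].

Variables (L k : nat) (hk : (k <= L)%N).

Definition first_cols N (U : 'M[R]_(N, L)) : 'M[R]_(N, k) :=
  \matrix_(i, j) U i (widen_ord hk j).

Definition last_cols N (U : 'M[R]_(N, L)) : 'M[R]_(N, L - k) :=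
  \matrix_(i, j) U i (cast_ord (subnKC hk) (rshift k j)).

Definition join_occ (mu : {ffun 'I_k -> bool}) (nu : {ffun 'I_(L - k) -> bool})
    : {ffun 'I_L -> bool} :=
  [ffun i => match fintype.split (cast_ord (esym (subnKC hk)) i) with
             | inl a => mu a
             | inr b => nu b
             end].

(* The 2^k x 2^(L-k) matrix whose rows (columns) are indexed by an enumeration
   of {0,1}^k (of {0,1}^(L-k)). *)
Definition reshape_tensor (T : {ffun 'I_L -> bool} -> R) :
    'M[R]_(#|{ffun 'I_k -> bool}|, #|{ffun 'I_(L - k) -> bool}|) :=
  \matrix_(r, c) T (join_occ (enum_val r) (enum_val c)).

End Matrices.

(* Main.v *)
Require Import Defs.
From mathcomp Require Import all_boot all_order all_algebra fingroup perm.
From mathcomp Require Import all_classical all_reals all_analysis.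
From mathcomp Require Import measurable_realfun polyrcf complex.
From mathcomp Require Import zify ring lra.
Set Implicit Arguments.
Unset Strict Implicit.
Unset Printing Implicit Defensive.
Import Order.TTheory GRing.Theory Num.Theory.
Local Open Scope ring_scope.

(** Why the theorem holds.

    The orthonormal functions phi_j are linearly independent, so a polynomial
    identity that is linear in each of the N column vectors
    (phi_j(x_b))_j, and holds for all points x_b, holds for arbitrary column
    vectors.  Taking unit vectors in the expansion of the Slater determinant
    shows that the occupation tensor consists of the N-by-N minors of U
    ([occupation_tensorE]), hence that the reshaped tensor has as its entry at
    (mu, nu) the determinant formed by the columns mu of V and nu of W
    ([pair_tensor], [reshape_occ_det]).

    Multiplying U on the left by a unitary matrix Q multiplies all these
    minors by the phase det Q and leaves the singular values unchanged.  Since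
    V V^T + W W^T = 1, one Q diagonalises both Gram matrices, with eigenvalues
    a_i and b_i = 1 - a_i in [0, 1] ([split_gram_spectrum]).  After this
    rotation the rows of V are orthogonal, and so are those of W.  Laplace
    expansion ([pair_det_laplace]) writes the tensor as a signed sum of
    rank-one terms v_R w_R^T over the subsets R of the N rows, where v_R lists
    the minors of V on the rows R and w_R those of W on the other rows.  By the
    Cauchy-Binet formula the v_R are pairwise orthogonal with squared norm
    prod_(i in R) a_i, and the w_R are pairwise orthogonal with squared norm
    prod_(i notin R) b_i.  The squared singular values are therefore, up to
    zeros, the weights
      e_R = prod_(i in R) a_i * prod_(i notin R) b_i
    counted over all R ([char_poly_pair_tensor]).

    A weight is nonzero exactly when R contains no i with a_i = 0 and every i
    with b_i = 0, so R is free on Z = {i | a_i != 0 and b_i != 0} only, and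
    there are 2^#|Z| nonzero weights; the rank hypotheses give
    #|Z| = min (N, k, L - k).  Complementing R inside Z is an involution that
    sends e_R to p / e_R with
      p = prod_(a_i != 0) a_i * prod_(b_i != 0) b_i
    ([subset_weight_flip]).  The map x |-> p / x thus permutes the nonzero
    weights and reverses their order, which pairs the j-th largest with the
    j-th smallest ([sorted_reciprocal_pairing]).  Finally the first factor of p
    is det (V V^T) or det (V^T V), whichever of the two Gram matrices is
    invertible, because both have the same nonzero eigenvalues
    ([det_gram_row_free], [det_gram_col_free]); likewise for W. *)

(** * Minors on a set of occupied columns *)

(** Multilinearity in the columns of the product.  Besides Cauchy-Binet, this
    is what turns an identity between Slater determinants into one between
    coefficient tensors. *)
Lemma det_mulmx_functions (K : comNzRingType) r n
    (X : 'M[K]_(r, n)) (Y : 'M[K]_(n, r)) :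
  \det (X *m Y) =
    \sum_(f : {ffun 'I_r -> 'I_n}) (\prod_j Y (f j) j) * \det (colsub f X).
Proof.
under [RHS]eq_bigr => f _ do rewrite -det_tr.
rewrite -[LHS]det_tr /determinant.
under [LHS]eq_bigr => s _.
  under eq_bigr => i _ do rewrite !mxE.
  rewrite bigA_distr_bigA /= mulr_sumr.
  over.
rewrite exchange_big /=; apply: eq_bigr => f _.
rewrite mulr_sumr.
apply: eq_bigr => s _; rewrite mulrCA big_split /= [\prod_i X _ _ * _]mulrC.
by congr (_ * (_ * _)); apply: eq_bigr => i _; rewrite !mxE.
Qed.

Lemma det_colsub_noninj (K : comNzRingType) r n (X : 'M[K]_(r, n))
    (f : 'I_r -> 'I_n) : ~~ injectiveb f -> \det (colsub f X) = 0.
Proof.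
move=> /injectivePn[i [j neq_ij eq_f]]; rewrite -det_tr.
by apply: (determinant_alternate neq_ij) => l; rewrite !mxE eq_f.
Qed.

Definition supp n (mu : {ffun 'I_n -> bool}) : seq 'I_n :=
  [seq i <- enum 'I_n | mu i].

Lemma mem_supp n (mu : {ffun 'I_n -> bool}) i : (i \in supp mu) = mu i.
Proof. by rewrite mem_filter mem_enum andbT. Qed.

Lemma uniq_supp n (mu : {ffun 'I_n -> bool}) : uniq (supp mu).
Proof. exact/filter_uniq/enum_uniq. Qed.

Lemma size_supp n (mu : {ffun 'I_n -> bool}) : size (supp mu) = (\sum_i mu i)%N.
Proof.
rewrite size_filter -sum1_count big_mkcond big_enum /=.
by apply: eq_bigr => i _; case: (mu i).
Qed.

(** The value is 0 when the number of selected columns differs from [r], so that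
    sums over all occupations need no side condition.  Entries are read from a
    list so that the size of the minor is [r] by construction; the default 0 of
    [nth] is never reached in the branch where it is used. *)
Definition occ_det (K : comNzRingType) r n (X : 'M[K]_(r, n))
    (mu : {ffun 'I_n -> bool}) : K :=
  if size (supp mu) == r then
    \det (\matrix_(i < r, j < r) nth 0 [seq X i c | c <- supp mu] j)
  else 0.

Lemma occ_det_tuple (K : comNzRingType) r n (X : 'M[K]_(r, n))
    (mu : {ffun 'I_n -> bool}) (t : r.-tuple 'I_n) :
  supp mu = t -> occ_det X mu = \det (colsub (tnth t) X).
Proof.
move=> eq_t; rewrite /occ_det eq_t size_tuple eqxx; congr (\det _).
apply/matrixP => i j; rewrite !mxE (nth_map (tnth t j)) ?size_tuple //.
by rewrite -tnth_nth.
Qed.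

(** Group the functions f of [det_mulmx_functions] by their image: functions
    that are not injective contribute 0, and those with image mu are the
    permutations of the increasing enumeration of mu. *)
Lemma cauchy_binet (K : comNzRingType) r n (X Y : 'M[K]_(r, n)) :
  \sum_(mu : {ffun 'I_n -> bool}) occ_det X mu * occ_det Y mu
    = \det (X *m Y^T).
Proof.
rewrite det_mulmx_functions.
rewrite (partition_big (fun f : {ffun 'I_r -> 'I_n} =>
  [ffun c => c \in codom f]) predT) //=; apply: eq_bigr => mu _.
rewrite (bigID (fun f : {ffun 'I_r -> 'I_n} => injectiveb f)) /= addrC big1 ?add0r; last first.
  by move=> f /andP[_ /det_colsub_noninj ->]; rewrite mulr0.
have suppE (f : {ffun 'I_r -> 'I_n}) :
    [ffun c => c \in codom f] = mu -> injective f -> perm_eq (supp mu) (codom f).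
  move=> <- inj_f; apply: uniq_perm => [|| c]; first exact: uniq_supp.
    by rewrite map_inj_uniq ?enum_uniq.
  by rewrite mem_supp ffunE.
have [sz|sz] := eqVneq (size (supp mu)) r; last first.
  rewrite /occ_det (negPf sz) mul0r big1 // => f /andP[/eqP Ef /injectiveP inj_f].
  case/eqP: sz; rewrite (perm_size (suppE f Ef inj_f)).
  by rewrite size_codom card_ord.
(* t enumerates mu, and h s runs through the injective functions of image mu. *)
pose t : r.-tuple 'I_n := tcast sz (in_tuple (supp mu)).
have tE : supp mu = t by rewrite val_tcast.
have inj_t : injective (tnth t) by apply/tuple_uniqP; rewrite -tE uniq_supp.
rewrite !(occ_det_tuple _ tE) [in X in _ * X]/determinant mulr_sumr.
pose h (s : 'S_r) : {ffun 'I_r -> 'I_n} := [ffun i => tnth t (s i)].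
have inj_h : injective h.
  move=> s1 s2 /ffunP eq_h; apply/permP => i; apply: inj_t.
  by have := eq_h i; rewrite !ffunE.
rewrite (eq_bigl [in [set h s | s in [set: 'S_r]]]); last first.
  move=> f; apply/andP/imsetP.
    move=> [/eqP Ef /injectiveP inj_f]; have/perm_mem mem_f := suppE f Ef inj_f.
    have ex i : exists j, tnth t j == f i.
      have : f i \in supp mu by rewrite mem_f codom_f.
      by rewrite tE => /tnthP[j ->]; exists j.
    have inj_s : injective (fun i => xchoose (ex i)).
      move=> i1 i2 eq_i; apply: inj_f.
      by rewrite -(eqP (xchooseP (ex i1))) eq_i (eqP (xchooseP (ex i2))).
    exists (perm inj_s) => //; apply/ffunP => i; rewrite ffunE permE.
    by rewrite (eqP (xchooseP (ex i))).
  move=> [s _ ->]; split; last first.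
    by apply/injectiveP => i j; rewrite !ffunE => /inj_t/perm_inj.
  apply/eqP/ffunP => c; rewrite ffunE -mem_supp tE.
  apply/codomP/tnthP => [[i ->]|[i ->]].
    by exists (s i); rewrite ffunE.
  by exists ((s^-1)%g i); rewrite ffunE permKV.
rewrite big_imset /=; last by move=> s1 s2 _ _; apply: inj_h.
apply: eq_big => [s|s _]; first by rewrite inE.
have -> : colsub (h s) X = col_perm s (colsub (tnth t) X).
  by apply/matrixP => i j; rewrite !mxE ffunE.
rewrite col_permE det_mulmx det_perm odd_permV mulrCA mulrA mulrC.
congr (_ * _); last by rewrite mulrC.
by apply: eq_bigr => i _; rewrite !mxE ffunE.
Qed.

(** Orthogonality of minors of two families of rows.  The families may have
    different lengths, and then no occupation selects a nonzero minor of both;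
    for equal lengths the hypothesis makes a row of the Gram matrix vanish. *)
Lemma sum_occ_det_eq0 (K : comNzRingType) r r' n
    (X : 'M[K]_(r, n)) (Y : 'M[K]_(r', n)) :
  (r = r' -> exists i, forall j, (X *m Y^T) i j = 0) ->
  \sum_(mu : {ffun 'I_n -> bool}) occ_det X mu * occ_det Y mu = 0.
Proof.
have [eq_r|neq_r] := eqVneq r r'; last first.
  move=> _; apply: big1 => mu _; rewrite /occ_det.
  have [->|] := eqVneq; last by rewrite mul0r.
  by rewrite (negPf neq_r) mulr0.
move: Y; rewrite -eq_r => Y /(_ erefl)[i rowi0]; rewrite cauchy_binet.
by rewrite (expand_det_row _ i) big1 // => j _; rewrite rowi0 mul0r.
Qed.

(** * Laplace expansion along a block of columns *)

Lemma det_lower_block (K : comNzRingType) N s m (F : nat -> nat -> K) :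
  (s + m)%N = N -> (forall i j, (i < s)%N -> (s <= j)%N -> F i j = 0) ->
  \det (\matrix_(i < N, j < N) F i j) =
    \det (\matrix_(i < s, j < s) F i j) *
    \det (\matrix_(i < m, j < m) F (s + i)%N (s + j)%N).
Proof.
move=> <- F0; rewrite -(det_lblock _ (\matrix_(i, j) F (s + i)%N j)).
congr (\det _); apply/matrixP => i j; rewrite mxE.
case: (split_ordP i) => i' ->; case: (split_ordP j) => j' ->.
- by rewrite block_mxEul mxE.
- by rewrite block_mxEur mxE F0 //= leq_addr.
- by rewrite block_mxEdl mxE.
- by rewrite block_mxEdr mxE.
Qed.

Definition row_order N (R : {set 'I_N}) : seq 'I_N := enum R ++ enum (~: R).

Lemma uniq_row_order N (R : {set 'I_N}) : uniq (row_order R).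
Proof.
rewrite cat_uniq !enum_uniq andbT /=; apply/hasPn => i.
by rewrite !mem_enum inE.
Qed.

Lemma size_row_order N (R : {set 'I_N}) : size (row_order R) = N.
Proof. by rewrite size_cat -!cardE cardsC card_ord. Qed.

Lemma row_perm_exists N (R : {set 'I_N}) :
  {s : 'S_N | forall i : 'I_N, s i = nth i (row_order R) i}.
Proof.
have inj_h : injective (fun i : 'I_N => nth i (row_order R) i).
  move=> i j /eqP; rewrite (set_nth_default j) ?size_row_order //.
  by rewrite nth_uniq ?size_row_order ?uniq_row_order // => /eqP/val_inj.
by exists (perm inj_h) => i; rewrite permE.
Qed.

(** The sign of the permutation moving the rows of [R] to the front; only its
    square matters below. *)
Definition row_sign (K : nzRingType) N (R : {set 'I_N}) : K :=
  (-1) ^+ odd_perm (sval (row_perm_exists R)).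

Lemma row_sign_sq (K : nzRingType) N (R : {set 'I_N}) :
  row_sign K R * row_sign K R = 1.
Proof. by rewrite -signr_addb addbb. Qed.

Lemma card_ord_below N s : (s <= N)%N -> #|[set j : 'I_N | (j < s)%N]| = s.
Proof.
move=> le_sN; have inj_w : injective (widen_ord le_sN).
  by move=> i j /(congr1 val) /= eq_ij; apply: val_inj.
rewrite -[RHS]card_ord -(card_imset _ inj_w).
apply: eq_card => j; rewrite inE; apply/idP/imsetP => [ltjs|[i _ ->]] /=.
  by exists (Ordinal ltjs) => //; apply: val_inj.
exact: (ltn_ord i).
Qed.

(** If the rows in [R] vanish outside the first [#|R|] columns and the other rows
    vanish on them, sorting the rows by [R] makes the matrix block diagonal. *)
Lemma det_rows_split (K : comNzRingType) N (R : {set 'I_N}) (F : 'I_N -> nat -> K) :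
  \det (\matrix_(i < N, j < N) if (i \in R) == (j < #|R|)%N then F i j else 0) =
    row_sign K R *
      (\det (\matrix_(i < #|R|, j < #|R|) F (enum_val i) j) *
       \det (\matrix_(i < #|~: R|, j < #|~: R|) F (enum_val i) (#|R| + j)%N)).
Proof.
have eqN : (#|R| + #|~: R|)%N = N by rewrite cardsC card_ord.
rewrite /row_sign; case: (row_perm_exists R) => t tE /=; set M := \matrix_(i, j) _.
have -> : \det M = (-1) ^+ t * \det (row_perm t M).
  by rewrite row_permE det_mulmx det_perm mulrA -signr_addb addbb mul1r.
congr (_ * _).
pose G i j : K := if (i < #|R|)%N == (j < #|R|)%N
  then nth 0 [seq F r j | r <- row_order R] i else 0.
have -> : row_perm t M = \matrix_(i, j) G i j.
  apply/matrixP => i j; rewrite !mxE tE /G (nth_map i) ?size_row_order //.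
  congr (if _ == _ then _ else _); rewrite /row_order nth_cat -cardE.
  case: ifP => ltis; first by rewrite -mem_enum mem_nth // -cardE.
  apply/negbTE; rewrite -finset.in_setC -mem_enum mem_nth // -cardE.
  by rewrite ltn_subLR ?eqN // leqNgt ltis.
rewrite (det_lower_block eqN) => [|i j ltis lesj]; last first.
  by rewrite /G ltis ltnNge lesj.
congr (_ * _); congr (\det _); apply/matrixP => i j; rewrite !mxE /G.
  rewrite !ltn_ord eqxx /row_order map_cat nth_cat size_map -cardE ltn_ord.
  by rewrite (nth_map (enum_val i)) -?cardE // -enum_val_nth.
rewrite !ltnNge !leq_addr eqxx /row_order map_cat nth_cat size_map -cardE.
rewrite ltnNge leq_addr addKn /= (nth_map (enum_val i)) -?cardE //.
by rewrite -enum_val_nth.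
Qed.

(** Split every row as the sum of its restriction to the first [s] columns and
    the rest, and expand over the set [R] of rows for which the first summand is
    chosen.  In the Leibniz formula a term survives only if its permutation maps
    [R] onto the first [s] columns, which forces [#|R| = s]. *)
Lemma laplace (K : comNzRingType) N s (F : 'I_N -> nat -> K) : (s <= N)%N ->
  \det (\matrix_(i < N, j < N) F i j) = \sum_(R : {set 'I_N} | #|R| == s)
    row_sign K R *
      (\det (\matrix_(i < #|R|, j < #|R|) F (enum_val i) j) *
       \det (\matrix_(i < #|~: R|, j < #|~: R|) F (enum_val i) (#|R| + j)%N)).
Proof.
move=> le_sN; set M := \matrix_(i, j) F i j.
pose part (R : {set 'I_N}) : 'M[K]_N := \matrix_(i, j)
  if (i \in R) == (j < s)%N then F i j else 0.
have -> : \det M = \sum_(R : {set 'I_N}) \det (part R).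
  rewrite /determinant exchange_big /=; apply: eq_bigr => /= t _.
  rewrite -mulr_sumr; congr (_ * _).
  pose F1 i := if (t i < s)%N then F i (t i) else 0.
  pose F2 i := if (t i < s)%N then 0 else F i (t i).
  transitivity (\prod_i (F1 i + F2 i)).
    by apply: eq_bigr => i _; rewrite /F1 /F2 mxE; case: ifP; rewrite ?addr0 ?add0r.
  rewrite bigA_distr; apply: eq_bigr => R _; apply: eq_bigr => i _.
  by rewrite mxE /F1 /F2; do 2!case: ifP.
rewrite (bigID (fun R : {set 'I_N} => #|R| == s)) /= [X in _ + X]big1 ?addr0.
  apply: eq_bigr => R /eqP cardR; rewrite -det_rows_split cardR.
  by congr (\det _); apply/matrixP => i j; rewrite !mxE.
move=> R neqR; rewrite /determinant big1 // => t _.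
have [/existsP[i /negPf bad]|] :=
  boolP [exists i, (i \in R) != (t i < s)%N].
  by rewrite (bigD1 i) //= mxE bad mul0r mulr0.
rewrite negb_exists => /fintype.forallP good; case/negP: neqR.
have -> : R = t @^-1: [set j : 'I_N | (j < s)%N].
  by apply/setP => i; have := good i; rewrite negbK !inE => /eqP.
by rewrite card_preimset ?card_ord_below //; exact: perm_inj.
Qed.

(** * Factorisation of the pair tensor *)

Definition rows_in (K : comNzRingType) N n (R : {set 'I_N}) (X : 'M[K]_(N, n)) :
  'M[K]_(#|R|, n) := rowsub (@enum_val _ (mem R)) X.

(** If R differs from S but has the same size, R has a row outside S, and that row
    of X is orthogonal to all rows of Y in S. *)
Lemma sum_occ_det_rows_in (K : comNzRingType) N n (X Y : 'M[K]_(N, n)) (d : 'rV[K]_N)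
    (R S : {set 'I_N}) : X *m Y^T = diag_mx d ->
  \sum_(mu : {ffun 'I_n -> bool})
      occ_det (rows_in R X) mu * occ_det (rows_in S Y) mu
    = (\prod_(i in R) d 0 i) *+ (R == S).
Proof.
move=> XY; have XYE i j : (rows_in R X *m (rows_in S Y)^T) i j =
    d 0 (enum_val i) *+ (enum_val i == enum_val j).
  have := congr1 (fun M : 'M[K]_N => M (enum_val i) (enum_val j)) XY.
  by rewrite !mxE => <-; apply: eq_bigr => l _; rewrite !mxE.
have [eqRS|neqRS] := eqVneq R S.
  move: XYE; rewrite -{S}eqRS cauchy_binet mulr1n => XYE.
  have -> : rows_in R X *m (rows_in R Y)^T = diag_mx (\row_j d 0 (enum_val j)).
    apply/matrixP => i j; rewrite XYE !mxE (inj_eq enum_val_inj).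
    by case: eqVneq => // ->.
  rewrite det_diag [RHS]big_enum_val; apply: eq_bigr => i _.
  by rewrite mxE.
rewrite mulr0n; apply: sum_occ_det_eq0 => eq_card.
have /subsetPn[i iR iS] : ~~ (R \subset S).
  by apply: contra neqRS => sRS; rewrite eqEcard sRS -eq_card leqnn.
exists (enum_rank_in iR i) => j; rewrite XYE enum_rankK_in //.
by case: eqP => // eq_i; rewrite eq_i enum_valP in iS.
Qed.

(** The entry of the reshaped tensor, with the two blocks of columns kept apart.
    Stated over any commutative ring, because the orbitals are rotated over the
    complex numbers although the tensor is real. *)
Definition pair_det (K : comNzRingType) N k l (V : 'M[K]_(N, k)) (W : 'M[K]_(N, l))
    (mu : {ffun 'I_k -> bool}) (nu : {ffun 'I_l -> bool}) : K :=
  if (size (supp mu) + size (supp nu) == N)%N then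
    \det (\matrix_(i < N, j < N)
      nth 0 ([seq V i c | c <- supp mu] ++ [seq W i c | c <- supp nu]) j)
  else 0.

Lemma pair_det_laplace (K : comNzRingType) N k l
    (V : 'M[K]_(N, k)) (W : 'M[K]_(N, l)) mu nu :
  pair_det V W mu nu = \sum_(R : {set 'I_N})
    row_sign K R * (occ_det (rows_in R V) mu * occ_det (rows_in (~: R) W) nu).
Proof.
rewrite /pair_det; case: ifP => [/eqP eqN|neqN]; last first.
  rewrite big1 // => R _; rewrite /occ_det.
  case: eqP => [eq_mu|]; last by rewrite mul0r mulr0.
  case: eqP => [eq_nu|]; last by rewrite !mulr0.
  by rewrite eq_mu eq_nu cardsC card_ord eqxx in neqN.
rewrite (laplace (fun r j => nth 0 ([seq V r c | c <- supp mu] ++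
  [seq W r c | c <- supp nu]) j) (s := size (supp mu))); last first.
  by rewrite -eqN leq_addr.
rewrite big_mkcond; apply: eq_bigr => R _; rewrite /occ_det.
rewrite [_ == size _]eq_sym; case: eqP => [eq_mu|]; last by rewrite mul0r mulr0.
have eq_nu : size (supp nu) = #|~: R|.
  by apply/eqP; rewrite -(eqn_add2l #|R|) -{1}eq_mu eqN cardsC card_ord.
rewrite eq_nu eqxx; congr (_ * (_ * _)); congr (\det _); apply/matrixP => i j.
  rewrite !mxE nth_cat size_map eq_mu ltn_ord; congr (nth _ _ _).
  by apply: eq_map => c; rewrite !mxE.
rewrite !mxE nth_cat size_map eq_mu ltnNge leq_addr addKn; congr (nth _ _ _).
by apply: eq_map => c; rewrite !mxE.
Qed.

Definition pair_tensor (K : comNzRingType) N k l (V : 'M[K]_(N, k)) (W : 'M[K]_(N, l)) :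
    'M[K]_(#|{ffun 'I_k -> bool}|, #|{ffun 'I_l -> bool}|) :=
  \matrix_(a, b) pair_det V W (enum_val a) (enum_val b).

Definition minors (K : comNzRingType) N n (X : 'M[K]_(N, n)) :
    'M[K]_(#|{set 'I_N}|, #|{ffun 'I_n -> bool}|) :=
  \matrix_(a, b) occ_det (rows_in (enum_val a) X) (enum_val b).

Definition co_minors (K : comNzRingType) N n (X : 'M[K]_(N, n)) :
    'M[K]_(#|{set 'I_N}|, #|{ffun 'I_n -> bool}|) :=
  \matrix_(a, b) occ_det (rows_in (~: enum_val a) X) (enum_val b).

Definition sign_row (K : nzRingType) N : 'rV[K]_#|{set 'I_N}| :=
  \row_a row_sign K (enum_val a).

(** The sum of rank-one terms given by Laplace expansion, in matrix form. *)
Lemma pair_tensorE (K : comNzRingType) N k l (V : 'M[K]_(N, k)) (W : 'M[K]_(N, l)) :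
  pair_tensor V W = (minors V)^T *m diag_mx (sign_row K N) *m co_minors W.
Proof.
apply/matrixP => a b; rewrite mxE pair_det_laplace (reindex _ (onW_bij _ (@enum_val_bij _))).
rewrite [RHS]mxE; apply: eq_bigr => c _.
by rewrite mul_mx_diag !mxE -mulrA mulrCA.
Qed.

Lemma minors_mul_tr (K : comNzRingType) N n (X Y : 'M[K]_(N, n)) (d : 'rV[K]_N) :
  X *m Y^T = diag_mx d ->
  minors X *m (minors Y)^T =
    diag_mx (\row_a \prod_(i in (enum_val a : {set 'I_N})) d 0 i).
Proof.
move=> XY; apply/matrixP => a b; rewrite !mxE.
rewrite -(inj_eq enum_val_inj) -(sum_occ_det_rows_in _ _ XY).
by rewrite [RHS](reindex _ (onW_bij _ (@enum_val_bij _))); apply: eq_bigr => c _; rewrite !mxE.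
Qed.

Lemma co_minors_mul_tr (K : comNzRingType) N n (X Y : 'M[K]_(N, n)) (d : 'rV[K]_N) :
  X *m Y^T = diag_mx d ->
  co_minors X *m (co_minors Y)^T =
    diag_mx (\row_a \prod_(i in ~: (enum_val a : {set 'I_N})) d 0 i).
Proof.
move=> XY; apply/matrixP => a b; rewrite !mxE.
rewrite -(inj_eq enum_val_inj) -(inj_eq (inv_inj (@finset.setCK _))).
rewrite -(sum_occ_det_rows_in _ _ XY).
by rewrite [RHS](reindex _ (onW_bij _ (@enum_val_bij _))); apply: eq_bigr => c _; rewrite !mxE.
Qed.

Lemma nth_map_zero (U V : nmodType) (f : U -> V) (s : seq U) j :
  f 0 = 0 -> nth 0 (map f s) j = f (nth 0 s j).
Proof. by move=> f0; elim: s j => [|x s IHs] [|j] //=. Qed.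

(** A rotation of the orbitals acts on the tensor by a scalar, so it does not
    affect its singular values. *)
Lemma pair_tensor_mull (K : comNzRingType) N k l
    (O : 'M[K]_N) (V : 'M[K]_(N, k)) (W : 'M[K]_(N, l)) :
  pair_tensor (O *m V) (O *m W) = \det O *: pair_tensor V W.
Proof.
apply/matrixP => a b; rewrite !mxE /pair_det; case: ifP => _; last by rewrite mulr0.
rewrite -det_mulmx; congr (\det _).
set s := supp _; set t := supp _.
pose cols : seq 'cV[K]_N := [seq col c V | c <- s] ++ [seq col c W | c <- t].
have colsE i (j : 'I_N) :
    (nth 0 cols j) i 0 = nth 0 ([seq V i c | c <- s] ++ [seq W i c | c <- t]) j.
  rewrite -(nth_map_zero (f := fun u : 'cV[K]_N => u i 0)) ?mxE // map_cat -!map_comp.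
  by congr (nth 0 (_ ++ _) j); apply: eq_map => c; rewrite /= mxE.
apply/matrixP => i j; rewrite !mxE.
transitivity ((O *m nth 0 cols j) i 0); last first.
  by rewrite mxE; apply: eq_bigr => c _; rewrite mxE colsE.
rewrite -(nth_map_zero (f := mulmx O)) ?mulmx0 //.
rewrite -(nth_map_zero (f := fun u : 'cV[K]_N => u i 0)) ?mxE //.
rewrite !map_cat -!map_comp.
by congr (nth 0 (_ ++ _) j); apply: eq_map => c; rewrite /= colE mulmxA -colE [RHS]mxE.
Qed.

Lemma map_pair_tensor (K L : comNzRingType) (f : {rmorphism K -> L}) N k l
    (V : 'M[K]_(N, k)) (W : 'M[K]_(N, l)) :
  map_mx f (pair_tensor V W) = pair_tensor (map_mx f V) (map_mx f W).
Proof.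
apply/matrixP => a b; rewrite !mxE /pair_det; case: ifP => _; last exact: rmorph0.
rewrite -det_map_mx; congr (\det _); apply/matrixP => i j; rewrite !mxE.
rewrite -nth_map_zero ?rmorph0 // map_cat -!map_comp.
by congr (nth 0 (_ ++ _) j); apply: eq_map => c; rewrite /= mxE.
Qed.

(** * Characteristic polynomials and Gram matrices *)

(** Both sides are the determinant of the block matrix (X, A; B, 1), reduced by
    column operations and by row operations. *)
Lemma char_poly_mulmxC (K : comNzRingType) m n (A : 'M[K]_(m, n)) (B : 'M[K]_(n, m)) :
  'X^n * char_poly (A *m B) = 'X^m * char_poly (B *m A).
Proof.
pose A' := map_mx polyC A; pose B' := map_mx polyC B.
pose M := block_mx ('X%:M : 'M[{poly K}]_m) A' B' (1%:M : 'M[{poly K}]_n).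
have E1 : M *m block_mx 1%:M 0 (- B') 1%:M =
    block_mx (char_poly_mx (A *m B)) A' 0 1%:M.
  rewrite mulmx_block !mulmx1 !mulmx0 !mul1mx !add0r subrr mulmxN.
  by rewrite /char_poly_mx map_mxM.
have E2 : block_mx 1%:M 0 (- B') ('X%:M) *m M =
    block_mx 'X%:M A' 0 (char_poly_mx (B *m A)).
  rewrite mulmx_block !mul1mx !mul0mx !addr0 mulmx1 !mulNmx.
  rewrite -scalar_mxC addNr addrC.
  by rewrite /char_poly_mx map_mxM.
have := congr1 determinant E2; have := congr1 determinant E1.
rewrite !det_mulmx !det_lblock !det_ublock !det1 !mulr1 !mul1r => ->.
by rewrite !det_scalar.
Qed.

Lemma char_poly_diag (K : comNzRingType) n (d : 'rV[K]_n) :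
  char_poly (diag_mx d) = \prod_i ('X - (d 0 i)%:P).
Proof.
rewrite char_poly_trig ?diag_mx_is_trig //.
by apply: eq_bigr => i _; rewrite mxE eqxx.
Qed.

Lemma char_poly_conj (K : idomainType) n (O O' G : 'M[K]_n) :
  O' *m O = 1%:M -> char_poly (O *m G *m O') = char_poly G.
Proof.
move=> OO; have := char_poly_mulmxC O (G *m O').
rewrite -[_ *m O]mulmxA OO mulmx1 mulmxA => /mulfI; apply.
by rewrite expf_neq0 ?polyX_eq0.
Qed.

(** With the tensor factored as P^T E Q, cyclicity of the characteristic
    polynomial moves the outer factor Q'^T to the other end, where all the
    products are Gram matrices of minors and hence diagonal.  The primed
    matrices stand for the complex conjugates of the others; leaving them
    independent keeps the statement algebraic. *)
Lemma char_poly_pair_tensor (K : comNzRingType) N k l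
    (V V' : 'M[K]_(N, k)) (W W' : 'M[K]_(N, l)) (d e : 'rV[K]_N) :
  V *m V'^T = diag_mx d -> W *m W'^T = diag_mx e ->
  'X^(#|{set 'I_N}|) * char_poly ((pair_tensor V' W')^T *m pair_tensor V W) =
  'X^(#|{ffun 'I_l -> bool}|) * \prod_(R : {set 'I_N})
     ('X - ((\prod_(i in R) d 0 i) * (\prod_(i in ~: R) e 0 i))%:P).
Proof.
move=> VV WW; rewrite !pair_tensorE !trmx_mul trmxK tr_diag_mx.
set E := diag_mx (sign_row K N); set Q := co_minors W; set Q' := co_minors W'.
rewrite -!mulmxA char_poly_mulmxC; congr (_ * _).
have PP : minors V' *m (minors V)^T =
    diag_mx (\row_a \prod_(i in (enum_val a : {set 'I_N})) d 0 i).
  by rewrite -[LHS]trmxK trmx_mul trmxK (minors_mul_tr VV) tr_diag_mx.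
rewrite (mulmxA (minors V')) PP -!mulmxA (co_minors_mul_tr WW).
rewrite !mulmx_diag char_poly_diag [RHS](reindex _ (onW_bij _ (@enum_val_bij _))) /=.
apply: eq_bigr => a _; rewrite !mxE; congr ('X - _%:P).
by rewrite mulrCA (mulrA (row_sign _ _)) row_sign_sq mul1r.
Qed.

(** Over an ordered field, Y X X^T = 0 implies (Y X)(Y X)^T = 0, whose diagonal
    entries are sums of squares, hence Y X = 0. *)
Lemma gram_mx_unit (R : realFieldType) m n (X : 'M[R]_(m, n)) :
  \rank X = m -> X *m X^T \in unitmx.
Proof.
move=> rankX; rewrite -row_free_unit -kermx_eq0; set Y := kermx _.
have YX0 : Y *m X = 0.
  have : (Y *m X) *m (Y *m X)^T = 0.
    by rewrite trmx_mul mulmxA -(mulmxA Y) mulmx_ker mul0mx.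
  move=> /matrixP gram0; apply/matrixP => i j; have /eqP := gram0 i i.
  rewrite !mxE psumr_eq0 => [/allP /(_ j (mem_index_enum _))|l _].
    by rewrite !mxE -expr2 sqrf_eq0 => /eqP.
  by rewrite !mxE -expr2 sqr_ge0.
by rewrite -(@mulmx_free_eq0 _ _ _ _ _ X) ?YX0 // /row_free rankX.
Qed.

Lemma char_poly_root_prod (K : idomainType) n (A : 'M[K]_n) (I : finType)
    (P : pred I) (d : I -> K) :
  char_poly A = \prod_(i | P i) ('X - (d i)%:P) ->
  #|P| = n /\ \prod_(i | P i) d i = \det A.
Proof.
move=> cpA; have cardP : #|P| = n.
  apply: succn_inj; rewrite -(size_char_poly A) cpA -big_filter size_prod_XsubC.
  by rewrite size_filter cardE /enum_mem size_filter.
split=> //; have := congr1 (fun p => p.[0]) cpA.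
rewrite horner_coef0 char_poly_det horner_prod.
under eq_bigr => i _ do rewrite hornerXsubC sub0r.
by rewrite prodrN cardP => /(mulfI _) ->; rewrite ?signr_eq0.
Qed.

Lemma det_gram_row_free (R : realFieldType) m n (X : 'M[R]_(m, n)) (d : 'I_m -> R) :
  char_poly (X *m X^T) = \prod_i ('X - (d i)%:P) -> \rank X = m ->
  (forall i, d i != 0) /\ \prod_(i | d i != 0) d i = \det (X *m X^T).
Proof.
move=> cpX rankX; have [_ prod_d] := char_poly_root_prod cpX.
have: \det (X *m X^T) != 0.
  by have := gram_mx_unit rankX; rewrite unitmxE unitfE.
rewrite -prod_d => /prodf_neq0 d_neq0; split=> [i|]; first exact: d_neq0.
by apply: eq_bigl => i; rewrite d_neq0.
Qed.

(** X X^T and X^T X have the same characteristic polynomial up to a power of the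
    indeterminate; X^T X is invertible, so cancelling that power leaves the
    nonzero eigenvalues of X X^T. *)
Lemma det_gram_col_free (R : realFieldType) m n (X : 'M[R]_(m, n)) (d : 'I_m -> R) :
  char_poly (X *m X^T) = \prod_i ('X - (d i)%:P) -> \rank X = n ->
  #|[pred i | d i != 0]| = n /\ \prod_(i | d i != 0) d i = \det (X^T *m X).
Proof.
move=> cpX rankX; set p := char_poly (X^T *m X).
pose q : {poly R} := \prod_(i | d i != 0) ('X - (d i)%:P).
have cpE : char_poly (X *m X^T) = 'X^(#|[pred i | d i == 0]|) * q.
  rewrite cpX (bigID (fun i => d i == 0)) /=; congr (_ * _).
  by rewrite -prodr_const; apply: eq_bigr => i /eqP ->; rewrite subr0.
have q0 : ~~ root q 0.
  rewrite /root horner_prod; apply/prodf_neq0 => i d_neq0.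
  by rewrite hornerXsubC sub0r oppr_eq0.
have p0 : ~~ root p 0.
  rewrite /root horner_coef0 char_poly_det mulf_neq0 ?signr_eq0 //.
  rewrite -{2}[X]trmxK -unitfE -unitmxE gram_mx_unit //.
  by rewrite mxrank_tr.
have := char_poly_mulmxC X X^T; rewrite cpE -/p mulrA -exprD => pq.
have mupX k : mup (0 : R) ('X^k : {poly R}) = k.
  by rewrite -['X]subr0 -polyC0 mup_XsubCX eqxx.
have eq_m : (n + #|[pred i | d i == 0%R]|)%N = m.
  by have := congr1 (mup (0 : R)) pq; rewrite !mupMl // !mupX.
move: pq; rewrite eq_m => /(mulfI _) qp.
by apply: char_poly_root_prod; rewrite -/p -qp ?expf_neq0 ?polyX_eq0.
Qed.

(** * Weights of subsets *)

Section SubsetWeights.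
Context (R : realFieldType) (I : finType) (a b : I -> R).
Context (a_ge0 : forall i, 0 <= a i) (b_ge0 : forall i, 0 <= b i).
Context (ab1 : forall i, a i + b i = 1).

Definition subset_weight (S : {set I}) : R :=
  \prod_i (if i \in S then a i else b i).

Let Z := [set i | (a i != 0) && (b i != 0)].

Lemma subset_weight_gt0 (S : {set I}) :
  (0 < subset_weight S) = [forall i, (if i \in S then a i else b i) != 0].
Proof.
rewrite lt0r prodr_ge0 ?andbT; last by move=> i _; case: ifP.
by apply/prodf_neq0/fintype.forallP => [nz i|nz i _]; apply: nz.
Qed.

(** The sets of positive weight are the unions of [set i | b i == 0] with a subset
    of Z: outside Z one of a i, b i vanishes and decides membership of i. *)
Lemma card_subset_weight_gt0 :
  #|[set S : {set I} | 0 < subset_weight S]| = (2 ^ #|Z|)%N.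
Proof.
rewrite -card_powerset.
have inj : {in powerset Z &, injective (fun S : {set I} => [set i | b i == 0] :|: S)}.
  move=> S1 S2; rewrite !inE => sZ1 sZ2 /setP eqS; apply/setP => i.
  have := eqS i; rewrite !inE; case: (eqVneq (b i) 0) => //= b0 _.
  have notin (S : {set I}) : S \subset Z -> (i \in S) = false.
    by move=> /fintype.subsetP sZ; apply/negP => /sZ; rewrite inE b0 eqxx andbF.
  by rewrite !notin.
rewrite -(card_in_imset inj); apply: eq_card => S; rewrite inE subset_weight_gt0.
apply/forallP/imsetP => [nz|[T]].
  exists (S :&: Z).
    by rewrite inE subsetIr.
  apply/setP => i; rewrite !inE; have := nz i.
  by case: ifP => iS; case: (eqVneq (b i) 0) => //= b0; rewrite ?andbF // => ->.
rewrite inE => /fintype.subsetP sZ -> i; rewrite !inE.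
case: (eqVneq (b i) 0) => b0 /=.
  by have := ab1 i; rewrite b0 addr0 => ->; rewrite oner_eq0.
by case: ifP => // /sZ; rewrite inE => /andP[].
Qed.

(** The product of the weights of two sets that are complementary inside Z and
    agree outside. *)
Definition full_weight : R := \prod_(i | a i != 0) a i * \prod_(i | b i != 0) b i.

Lemma full_weight_gt0 : 0 < full_weight.
Proof.
by rewrite mulr_gt0 // prodr_gt0 // => i nz; rewrite lt0r nz /=.
Qed.

(* The symmetric difference of S and Z. *)
Let flip (S : {set I}) : {set I} := [set i | (i \in S) (+) (i \in Z)].

Let flipK : involutive flip.
Proof. by move=> S; apply/setP => i; rewrite !inE addbK. Qed.

(** For i in Z one set contributes a i and the other b i.  For i outside Z both
    contribute the same factor; it is nonzero as the weight is positive, so the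
    other one of a i, b i vanishes and the factor is 1 because a i + b i = 1.
    Hence it does not matter that it occurs squared. *)
Lemma subset_weight_flip (S : {set I}) : 0 < subset_weight S ->
  subset_weight S * subset_weight (flip S) = full_weight.
Proof.
rewrite subset_weight_gt0 => /fintype.forallP nz.
rewrite /full_weight -big_split [X in _ = X * _]big_mkcond.
rewrite [X in _ = _ * X]big_mkcond -big_split; apply: eq_bigr => i _ /=.
have := nz i; rewrite !inE; have := ab1 i.
case: (i \in S) => /=.
  case: (eqVneq (b i) 0) => [->|nzb ab1' ->]; last by rewrite /= mulrC.
  by rewrite addr0 => ->; rewrite oner_eq0 /= !mulr1.
case: (eqVneq (a i) 0) => [->|nza ab1' ->]; last by rewrite /= mulrC.
by rewrite add0r => ->; rewrite oner_eq0 /= !mulr1.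
Qed.

Lemma perm_subset_weights (t : seq R) :
  t = [seq x <- [seq subset_weight A | A <- enum {set I}] | 0 < x] ->
  perm_eq [seq full_weight / x | x <- t] t.
Proof.
move=> ->; rewrite seq.filter_map -map_comp; set s := seq.filter _ _.
have s_gt0 A : (A \in s) = (0 < subset_weight A).
  by rewrite mem_filter mem_enum andbT.
have -> : [seq ((fun x => full_weight / x) \o subset_weight) A | A <- s] =
    [seq subset_weight A | A <- [seq flip A | A <- s]].
  rewrite -map_comp; apply/eq_in_map => A; rewrite s_gt0 => wS /=.
  by rewrite -(subset_weight_flip wS) mulrC mulKf // gt_eqF.
apply/perm_map/uniq_perm => [|| A].
- by rewrite (map_inj_uniq (inv_inj flipK)) filter_uniq ?enum_uniq.
- by rewrite filter_uniq ?enum_uniq.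
rewrite -{1}[A]flipK (mem_map (inv_inj flipK)) !s_gt0.
have flip_gt0 T : 0 < subset_weight T -> 0 < subset_weight (flip T).
  move=> wT; have := full_weight_gt0; rewrite -(subset_weight_flip wT).
  by rewrite pmulr_rgt0.
by apply/idP/idP => /flip_gt0; rewrite ?flipK.
Qed.

End SubsetWeights.

(** * Simultaneous diagonalisation of the two Gram matrices *)

Section SplitGram.
Local Open Scope sesquilinear_scope.
Local Notation toC := (real_complex _).

Lemma conj_real_mx (R : rcfType) m n (A : 'M[R]_(m, n)) :
  map_mx Num.conj (map_mx toC A) = map_mx toC A.
Proof. by apply/matrixP => i j; rewrite !mxE conj_Creal // complex_real. Qed.

(** The spectral theorem for the Hermitian matrix G over the complex numbers.  A
    complex unitary matrix serves as well as a real orthogonal one, as only the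
    modulus of its determinant enters. *)
Lemma real_symmetric_diagonalization (R : rcfType) n (G : 'M[R]_n) : G^T = G ->
  exists (O : 'M[R[i]]_n) (d : 'rV[R]_n),
    O *m O^t* = 1%:M /\
    O *m map_mx toC G *m O^t* = diag_mx (map_mx toC d).
Proof.
move=> symG; set A := map_mx toC G.
have hermA : A \is hermsymmx.
  apply/is_hermitianmxP; rewrite expr0 scale1r [in RHS]/A map_trmx symG.
  by rewrite conj_real_mx.
have /orthomx_spectralP specA := hermitian_normalmx hermA.
exists (spectralmx A), (map_mx (fun z : R[i] => complex.Re z) (spectral_diag A)).
have unit_O := spectral_unitarymx A; split; first exact/unitarymxP.
rewrite {2}specA -invmx_unitary // !mulmxA mulmxV ?spectral_unit // mul1mx.
rewrite -mulmxA mulmxV ?spectral_unit // mulmx1; congr diag_mx.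
apply/matrixP => i j; rewrite !mxE RRe_real //.
exact/mxOverP/hermitian_spectral_diag_real.
Qed.

(** The conjugate of the rotated tensor is the conjugate of det Q times the
    original real tensor, and det Q has modulus 1; so T^T T is the product of
    the rotated tensor with its conjugate, to which [char_poly_pair_tensor]
    applies.  The eigenvalues are nonnegative because they are the squared norms
    of the rows of Q V and Q W. *)
Lemma split_gram_spectrum (R : rcfType) N k l (V : 'M[R]_(N, k)) (W : 'M[R]_(N, l)) :
  V *m V^T + W *m W^T = 1%:M ->
  exists d : 'I_N -> R,
  [/\ forall i, 0 <= d i <= 1,
      char_poly (V *m V^T) = \prod_i ('X - (d i)%:P),
      char_poly (W *m W^T) = \prod_i ('X - (1 - d i)%:P) &
      'X^(#|{set 'I_N}|) * char_poly ((pair_tensor V W)^T *m pair_tensor V W) =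
      'X^(#|{ffun 'I_l -> bool}|) *
        \prod_(S : {set 'I_N}) ('X - (subset_weight d (fun i => 1 - d i) S)%:P)].
Proof.
move=> VW1; have symG : (V *m V^T)^T = V *m V^T by rewrite trmx_mul trmxK.
have [Q [d [OO1 OGO]]] := real_symmetric_diagonalization symG.
have OO1' : Q^t* *m Q = 1%:M by apply: mulmx1C.
pose e : 'rV[R]_N := \row_i (1 - d 0 i).
have OHO : Q *m map_mx toC (W *m W^T) *m Q^t* = diag_mx (map_mx toC e).
  have -> : W *m W^T = 1%:M - V *m V^T by rewrite -VW1 addrAC subrr add0r.
  rewrite map_mxB map_mx1 mulmxBr mulmxBl mulmx1 OO1 OGO.
  apply/matrixP => i j; rewrite !mxE; case: eqVneq => _.
    by rewrite !mulr1n rmorphB rmorph1.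
  by rewrite !mulr0n subr0.
have toC_inj : injective (map_poly (real_complex R)) by apply: map_poly_inj.
have cp_diag m (X : 'M[R]_(N, m)) (c : 'rV[R]_N) :
    Q *m map_mx toC (X *m X^T) *m Q^t* = diag_mx (map_mx toC c) ->
    char_poly (X *m X^T) = \prod_i ('X - (c 0 i)%:P).
  move=> OXO; apply: toC_inj; rewrite map_char_poly -(char_poly_conj _ OO1') OXO.
  rewrite char_poly_diag rmorph_prod; apply: eq_bigr => i _ /=.
  by rewrite rmorphB /= map_polyX map_polyC mxE.
have QXQ m (X : 'M[R]_(N, m)) : Q *m map_mx toC X *m (Q *m map_mx toC X)^t* =
    Q *m map_mx toC (X *m X^T) *m Q^t*.
  rewrite trmx_mul map_mxM /= (map_trmx toC) conj_real_mx !mulmxA.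
  by rewrite -(mulmxA Q) -map_mxM.
have QXQ' m (X : 'M[R]_(N, m)) :
    Q *m map_mx toC X *m (map_mx Num.conj (Q *m map_mx toC X))^T =
    Q *m map_mx toC (X *m X^T) *m Q^t*.
  by rewrite map_trmx QXQ.
have ge0_diag m (X : 'M[R]_(N, m)) (c : 'rV[R]_N) i :
    Q *m map_mx toC (X *m X^T) *m Q^t* = diag_mx (map_mx toC c) -> 0 <= c 0 i.
  set Y := Q *m map_mx toC X => OXO; rewrite -lecR.
  have -> : (c 0 i)%:C%C = (Y *m Y^t*) i i by rewrite QXQ OXO !mxE eqxx mulr1n.
  by rewrite mxE sumr_ge0 // => j _; rewrite !mxE mul_conjC_ge0.
exists (d 0); split.
- move=> i; rewrite (ge0_diag _ _ _ i OGO) /= -subr_ge0.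
  by have := ge0_diag _ _ _ i OHO; rewrite mxE.
- exact: cp_diag OGO.
- by rewrite (cp_diag _ _ _ OHO); apply: eq_bigr => i _; rewrite mxE.
have detQ : Num.conj (\det Q) * \det Q = 1.
  by rewrite -det_map_mx -det_tr map_trmx -det_mulmx OO1' det1.
have TE : map_mx toC ((pair_tensor V W)^T *m pair_tensor V W) =
    (pair_tensor (map_mx Num.conj (Q *m map_mx toC V))
                 (map_mx Num.conj (Q *m map_mx toC W)))^T *m
    pair_tensor (Q *m map_mx toC V) (Q *m map_mx toC W).
  rewrite -map_pair_tensor pair_tensor_mull map_mxZ /= -map_pair_tensor conj_real_mx.
  rewrite [(_ *: _)^T]linearZ /= -scalemxAl -scalemxAr scalerA detQ scale1r.
  by rewrite map_mxM map_trmx.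
apply: toC_inj; rewrite !rmorphM /= !map_polyXn map_char_poly TE.
rewrite (char_poly_pair_tensor (etrans (QXQ' _ V) OGO) (etrans (QXQ' _ W) OHO)).
congr (_ * _); rewrite rmorph_prod; apply: eq_bigr => S _ /=.
rewrite rmorphB /= map_polyX map_polyC; congr ('X - _%:P).
rewrite -[RHS]/(real_complex R (subset_weight _ _ S)) rmorph_prod.
rewrite big_mkcond [X in _ * X]big_mkcond -big_split.
apply: eq_bigr => i _; rewrite !inE; case: ifP => _ /=; rewrite ?mulr1 ?mul1r.
  by rewrite mxE.
by rewrite !mxE.
Qed.

End SplitGram.

(** * Ordered lists of singular values *)

Lemma sorted_flatten_nseq (d : Order.disp_t) (T : orderType d) (m : T -> nat) (s : seq T) :
  sorted >=%O s -> sorted >=%O (flatten [seq nseq (m x) x | x <- s]).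
Proof.
have geT : transitive (>=%O : rel T) by move=> y x z xy yz; apply: le_trans yz xy.
rewrite !sorted_pairwise //; elim: s => //= x s IHs /andP[ge_x /IHs sorted_s].
rewrite pairwise_cat sorted_s andbT; apply/andP; split; last first.
  by elim: (m x) => //= n IHn; rewrite IHn andbT; apply/allP => y /nseqP[-> _] /=.
apply/allrelP => y z /nseqP[-> _] /flattenP[_ /mapP[w ws ->] /nseqP[-> _]].
exact: (allP ge_x).
Qed.

(** Two nonincreasing lists with the same multiplicities are equal, so the
    multiplicities of the positive roots determine the list. *)
Lemma nonzero_singular_valuesE (R : realType) m n (A : 'M[R]_(m, n)) (t : seq R) :
  (forall x, 0 < x -> mup x (char_poly (A^T *m A)) = count_mem x t) ->
  nonzero_singular_values A =
    [seq Num.sqrt x | x <- sort >=%R [seq x <- t | 0 < x]].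
Proof.
rewrite /nonzero_singular_values; set p := char_poly _ => mupE; congr map.
have geT : transitive (>=%R : rel R) by move=> y x z xy yz; apply: le_trans yz xy.
have p_neq0 : p != 0 by rewrite monic_neq0 ?char_poly_monic.
apply: (sorted_eq geT).
- by move=> x y /andP[xy yx]; apply/le_anti/andP.
- apply: sorted_filter => //; apply: sorted_flatten_nseq.
  by rewrite rev_sorted; apply: sub_sorted (sorted_roots _ _ _) => x y /ltW.
- by apply: sort_sorted => x y; apply: le_total.
rewrite perm_sym perm_sort perm_sym; apply/allP => x _ /=; apply/eqP.
rewrite !count_filter; have [x_gt0|x_le0] := ltP 0 x; last first.
  by rewrite !(@eq_count _ _ pred0) ?count_pred0 // => y /=;
    case: eqP => // ->; rewrite ltNge x_le0.
have cnt (s : seq R) : count (predI (pred1 x) (fun y => 0 < y)) s = count_mem x s.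
  by apply: eq_count => y /=; case: eqP => //= ->.
rewrite !cnt -mupE // count_flatten -map_comp.
have -> : sumn (map (count_mem x \o fun y => nseq (mup y p) y) (rev (rootsR p))) =
    ((count_mem x (rev (rootsR p))) * mup x p)%N.
  elim: (rev _) => //= y s ->; rewrite mulnDl count_nseq /=.
  by case: eqP => // ->.
rewrite count_rev count_uniq_mem ?uniq_roots //.
have [|] := boolP (x \in rootsR p); first by rewrite mul1n.
move=> xroot; rewrite mul0n mupNroot //; apply: contra xroot => rt.
by have := roots_on_rootsR p_neq0 x; rewrite in_itv /= rt => <-.
Qed.

(** The map x |-> c / x reverses the order, so the sorted list equals the reverse
    of its image. *)
Lemma sorted_reciprocal_pairing (R : realFieldType) (c : R) (t : seq R) (j : nat) :
  0 < c -> all (> 0) t -> perm_eq [seq c / x | x <- t] t -> (j < size t)%N ->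
  (sort >=%R t)`_j * (sort >=%R t)`_(size t - j.+1) = c.
Proof.
move=> c_gt0 t_gt0 perm_t ltj; set s := sort _ t.
have perm_s : perm_eq s t by rewrite perm_sort.
have size_s : size s = size t := perm_size perm_s.
have sorted_s : sorted >=%R s by apply: sort_sorted => x y; apply: le_total.
have s_gt0 i : (i < size s)%N -> 0 < s`_i.
  by move=> lti; apply: (allP t_gt0); rewrite -(perm_mem perm_s) mem_nth.
have geT : transitive (>=%R : rel R) by move=> y x z xy yz; apply: le_trans yz xy.
have sE : s = rev [seq c / x | x <- s].
  apply: (sorted_eq geT) => //.
  - by move=> x y /andP[xy yx]; apply/le_anti/andP.
  - rewrite rev_sorted sorted_map.
    apply: (sub_in_sorted (P := [in t])) sorted_s.
      by move=> x y xt yt /=; rewrite ler_pM2l // lef_pV2 //; apply: (allP t_gt0).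
    by apply/allP => x; rewrite (perm_mem perm_s).
  rewrite perm_sym perm_rev perm_sym.
  apply: (perm_trans perm_s); rewrite perm_sym.
  exact: perm_trans (perm_map _ perm_s) perm_t.
rewrite [X in _ * X`_ _]sE nth_rev size_map size_s; last by rewrite subnSK // leq_subr.
rewrite subnSK // subKn; last exact: ltnW.
rewrite (nth_map 0) ?size_s // mulrCA divff ?mulr1 //.
by rewrite gt_eqF // s_gt0 ?size_s.
Qed.

(** * Singular values of the reshaped tensor of minors *)

Lemma sorted_supp n (mu : {ffun 'I_n -> bool}) :
  pairwise (fun i j : 'I_n => (i < j)%N) (supp mu).
Proof.
rewrite -sorted_pairwise; last by move=> j i l; apply: ltn_trans.
apply: sorted_filter; first by move=> j i l; apply: ltn_trans.
by have := iota_ltn_sorted 0 n; rewrite -val_enum_ord sorted_map.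
Qed.

(** Both sides are strictly increasing lists with the same elements. *)
Lemma supp_join_occ L k (hk : (k <= L)%N) mu nu :
  supp (join_occ hk mu nu) =
    [seq widen_ord hk i | i <- supp mu] ++
    [seq cast_ord (subnKC hk) (rshift k i) | i <- supp nu].
Proof.
have ltT n : transitive (fun i j : 'I_n => (i < j)%N).
  by move=> j i l; apply: ltn_trans.
apply: (irr_sorted_eq (ltT L)) => [i|||i]; first exact: ltnn.
- by rewrite (sorted_pairwise (ltT L)) sorted_supp.
- rewrite (sorted_pairwise (ltT L)) pairwise_cat !pairwise_map sorted_supp /=.
  have -> : pairwise (relpre (fun i => cast_ord (subnKC hk) (rshift k i))
    (fun i j : 'I_L => (i < j)%N)) (supp nu).
    by apply: sub_pairwise (sorted_supp nu) => i j /=; rewrite ltn_add2l.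
  rewrite andbT; apply/allrelP => _ _ /mapP[i _ ->] /mapP[j _ ->] /=.
  exact: ltn_addr.
rewrite mem_supp ffunE mem_cat.
case: (split_ordP (cast_ord (esym (subnKC hk)) i)) => i' eq_i.
  have -> : i = widen_ord hk i' by apply: val_inj; have /(congr1 val) := eq_i.
  rewrite mem_map; last by move=> x y /(congr1 val) /= eq_xy; apply: val_inj.
  rewrite mem_supp; case: (mu i') => //=; symmetry; apply/negbTE/mapP => -[j _].
  by move=> /(congr1 val) /= eq_ij; have := ltn_ord i'; rewrite eq_ij ltnNge leq_addr.
have -> : i = cast_ord (subnKC hk) (rshift k i').
  by apply: val_inj; have /(congr1 val) := eq_i.
have inj_r : injective (fun j => cast_ord (subnKC hk) (rshift k j)).
  by move=> x y /(congr1 val) /= /addnI eq_xy; apply: val_inj.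
rewrite orbC (mem_map inj_r (supp nu) i') mem_supp.
case: (nu i') => //=; symmetry; apply/negbTE/mapP => -[j _].
by move=> /(congr1 val) /= eq_ij; have := ltn_ord j; rewrite -eq_ij ltnNge leq_addr.
Qed.

Lemma reshape_occ_det (R : realType) N L k (hk : (k <= L)%N) (U : 'M[R]_(N, L)) T :
  (forall mu, T mu = occ_det U mu) ->
  reshape_tensor hk T = pair_tensor (first_cols hk U) (last_cols hk U).
Proof.
move=> TE; apply/matrixP => a b; rewrite !mxE TE /occ_det /pair_det supp_join_occ.
rewrite size_cat !size_map; case: ifP => // _; congr (\det _).
apply/matrixP => i j; rewrite !mxE map_cat -!map_comp.
by congr (nth 0 (_ ++ _) j); apply: eq_map => c; rewrite /= mxE.
Qed.

Lemma gram_first_last_cols (R : realType) N L k (hk : (k <= L)%N) (U : 'M[R]_(N, L)) :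
  first_cols hk U *m (first_cols hk U)^T + last_cols hk U *m (last_cols hk U)^T =
    U *m U^T.
Proof.
apply/matrixP => i j; rewrite !mxE.
rewrite [RHS](reindex (cast_ord (subnKC hk))) /=; last first.
  exact/onW_bij/(Bijective (cast_ordK _) (cast_ordKV _)).
rewrite big_split_ord /=; congr (_ + _); apply: eq_bigr => c _; rewrite !mxE //.
by congr (U i _ * U j _); apply: val_inj.
Qed.

(** The linear algebra of the theorem, separated from the orbitals: all that is
    used of the tensor is that its entries are the minors of a matrix with
    orthonormal rows. *)
Lemma reshape_singular_values (R : realType) N L k (hk : (k <= L)%N)
    (U : 'M[R]_(N, L)) (T : {ffun 'I_L -> bool} -> R) :
  U *m U^T = 1%:M -> (forall mu, T mu = occ_det U mu) ->
  let V := first_cols hk U in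
  let W := last_cols hk U in
  full_rank V -> full_rank W -> (N <= k)%N \/ (N <= L - k)%N ->
  let sigma := nonzero_singular_values (reshape_tensor hk T) in
  let d := minn (2 ^ k) (minn (2 ^ N) (2 ^ (L - k))) in
  size sigma = d /\
  exists p : R,
    [/\ forall j : nat, (1 <= j <= d)%N ->
          sigma`_(j - 1) ^+ 2 * sigma`_(d - j) ^+ 2 = p,
        (k <= N)%N -> (N <= L - k)%N ->
          p = \det (V^T *m V) * \det (W *m W^T),
        (N <= k)%N -> (N <= L - k)%N ->
          p = \det (V *m V^T) * \det (W *m W^T)
      & (N <= k)%N -> (L - k <= N)%N ->
          p = \det (V *m V^T) * \det (W^T *m W)].
Proof.
move=> UU1 TE V W rankV rankW N_small sigma d.
have [a [a01 cpV cpW]] := split_gram_spectrum (etrans (gram_first_last_cols hk U) UU1).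
pose b i := 1 - a i; rewrite -/V -/W -/b in cpV cpW *.
rewrite -(reshape_occ_det _ TE) => cpT.
have a_ge0 i : 0 <= a i by have /andP[] := a01 i.
have b_ge0 i : 0 <= b i by rewrite subr_ge0; have /andP[] := a01 i.
have ab1 i : a i + b i = 1 by rewrite addrC subrK.
pose t := [seq subset_weight a b A | A <- enum {set 'I_N}].
pose t_pos := [seq x <- t | 0 < x]; pose s := sort >=%R t_pos.
have sigmaE : sigma = [seq Num.sqrt x | x <- s].
  apply: nonzero_singular_valuesE => x x_gt0.
  have X_x n : ~~ root ('X^n : {poly R}) x.
    by rewrite /root hornerXn expf_neq0 // gt_eqF.
  have := congr1 (mup x) cpT; rewrite !mupMr // => ->.
  by rewrite -mu_prod_XsubC /t big_map big_enum.
pose Z := [set i | (a i != 0) && (b i != 0)].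
have size_t : size t_pos = (2 ^ #|Z|)%N.
  rewrite -(card_subset_weight_gt0 a_ge0 b_ge0 ab1) cardE /t_pos seq.filter_map.
  rewrite size_map !size_filter enumT.
  by apply: eq_count => A /=; rewrite inE.
have row_V := det_gram_row_free cpV; have row_W := det_gram_row_free cpW.
have col_V := det_gram_col_free cpV; have col_W := det_gram_col_free cpW.
have size_s : size sigma = (2 ^ #|Z|)%N.
  by rewrite sigmaE size_map size_sort size_t.
(* By N_small and the ranks, one of a, b has no zero; Z is the support of the other. *)
have cardZ : #|Z| = minn N (minn k (L - k)).
  have cardZa : (forall i, a i != 0) -> #|Z| = #|[pred i | b i != 0]|.
    by move=> a_neq0; apply: eq_card => i; rewrite !inE a_neq0.
  have cardZb : (forall i, b i != 0) -> #|Z| = #|[pred i | a i != 0]|.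
    by move=> b_neq0; apply: eq_card => i; rewrite !inE b_neq0 andbT.
  have all_card (f : 'I_N -> R) : (forall i, f i != 0) -> #|[pred i | f i != 0]| = N.
    by move=> f_neq0; rewrite -[RHS]card_ord; apply: eq_card => i; rewrite !inE f_neq0.
  have [le_Nk|/ltnW le_kN] := leqP N k.
    have [a_neq0 _] := row_V (etrans rankV (minn_idPl le_Nk)).
    rewrite cardZa //; have [le_Nl|/ltnW le_lN] := leqP N (L - k).
      have [b_neq0 _] := row_W (etrans rankW (minn_idPl le_Nl)).
      by rewrite all_card //; lia.
    by have [-> _] := col_W (etrans rankW (minn_idPr le_lN)); lia.
  have [le_Nk|le_Nl] := N_small.
    have eqNk : N = k by lia.
    have [a_neq0 _] := row_V (etrans rankV (minn_idPl le_Nk)).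
    rewrite cardZa //; have [le_Nl|/ltnW le_lN] := leqP N (L - k).
      have [b_neq0 _] := row_W (etrans rankW (minn_idPl le_Nl)).
      by rewrite all_card //; lia.
    by have [-> _] := col_W (etrans rankW (minn_idPr le_lN)); lia.
  have [b_neq0 _] := row_W (etrans rankW (minn_idPl le_Nl)).
  by rewrite cardZb //; have [-> _] := col_V (etrans rankV (minn_idPr le_kN)); lia.
have dE : d = (2 ^ #|Z|)%N.
  rewrite /d cardZ; have exp_minn m n : (2 ^ minn m n = minn (2 ^ m) (2 ^ n))%N.
    by case: (leqP m n) => [le_mn|/ltnW le_nm];
      [rewrite (minn_idPl _)|rewrite (minn_idPr _)]; rewrite ?leq_exp2l.
  by rewrite !exp_minn minnCA.
split; first by rewrite size_s dE.
exists (full_weight a b); split.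
- move=> j /andP[j_gt0 le_jd]; rewrite sigmaE.
  have t_gt0 : all (> 0) t_pos by apply: filter_all.
  have s_ge0 i : 0 <= s`_i.
    have [lt_i|le_i] := ltnP i (size s); last by rewrite nth_default.
    by apply/ltW/(allP t_gt0); rewrite -(mem_sort >=%R) mem_nth.
  rewrite !nth_map_zero ?sqrtr0 // !sqr_sqrtr //.
  have perm_t : perm_eq [seq full_weight a b / x | x <- t_pos] t_pos.
    exact: perm_subset_weights.
  have w_gt0 := full_weight_gt0 a_ge0 b_ge0.
  have := sorted_reciprocal_pairing w_gt0 t_gt0 perm_t (j := (j - 1)%N).
  by rewrite size_t -dE -subSn // subSS subn0; apply; lia.
- move=> le_kN le_Nl.
  have [_ <-] := row_W (etrans rankW (minn_idPl le_Nl)).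
  by have [_ <-] := col_V (etrans rankV (minn_idPr le_kN)).
- move=> le_Nk le_Nl.
  have [_ <-] := row_W (etrans rankW (minn_idPl le_Nl)).
  by have [_ <-] := row_V (etrans rankV (minn_idPl le_Nk)).
move=> le_Nk le_lN.
have [_ <-] := col_W (etrans rankW (minn_idPr le_lN)).
by have [_ <-] := row_V (etrans rankV (minn_idPl le_Nk)).
Qed.

(** * The occupation tensor consists of the minors of the coefficient matrix *)

Definition integrable3 (R : realType) (u : R * R * R -> R) : Prop :=
  ((@lebesgue_measure R \x @lebesgue_measure R) \x @lebesgue_measure R)%E.-integrable
    setT (EFin \o u).

(** Domination of |u v| by u^2 + v^2. *)
Lemma integrable3_mul (R : realType) (u v : R * R * R -> R) :
  L2_R3 u -> L2_R3 v -> integrable3 (fun r => u r * v r).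
Proof.
move=> [mu iu] [mv iv]; apply: (le_integrable _ _ _ (integrableD _ iu iv)) => //.
  by apply/measurable_EFinP; exact: measurable_funM.
move=> x _; change (`|u x * v x|%:E <= `|u x ^+ 2 + v x ^+ 2|%:E)%E.
rewrite lee_fin [leRHS]ger0_norm ?addr_ge0 ?sqr_ge0 //.
by rewrite ler_norml; apply/andP; split; nra.
Qed.

Lemma int3_lincomb (R : realType) (a b : R) (u v w : R * R * R -> R) :
  integrable3 u -> integrable3 v -> integrable3 w ->
  integrable3 (fun r => a * u r + b * v r + w r) /\
  int3 (fun r => a * u r + b * v r + w r) = a * int3 u + b * int3 v + int3 w.
Proof.
move=> iu iv iw.
have iau : integrable3 (fun r => a * u r) by exact: (integrableZl measurableT a iu).
have ibv : integrable3 (fun r => b * v r) by exact: (integrableZl measurableT b iv).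
have iab : integrable3 (fun r => a * u r + b * v r) by exact: (integrableD measurableT iau ibv).
split; first exact: (integrableD measurableT iab iw).
by rewrite /int3 RintegralD // RintegralD // !RintegralZl.
Qed.

(** Integrability of the real and imaginary parts of the integrand of [l2_dot];
    it is what makes [l2_dot] additive, integrals being total functions. *)
Definition dot_integrable (R : realType) (f g : @spin_space R -> R[i]) : Prop :=
  forall s : bool,
    integrable3 (fun r => complex.Re (f (r, s)) * complex.Re (g (r, s)) +
                          complex.Im (f (r, s)) * complex.Im (g (r, s))) /\
    integrable3 (fun r => complex.Re (f (r, s)) * complex.Im (g (r, s)) -
                          complex.Im (f (r, s)) * complex.Re (g (r, s))).

Lemma H1_dot_integrable (R : realType) (f g : @spin_space R -> R[i]) :
  H1 f -> H1 g -> dot_integrable f g.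
Proof.
move=> Hf Hg s; have [[Rf _] [If _]] := Hf s; have [[Rg _] [Ig _]] := Hg s.
split.
  exact: (integrableD measurableT (integrable3_mul Rf Rg) (integrable3_mul If Ig)).
exact: (integrableB measurableT (integrable3_mul Rf Ig) (integrable3_mul If Rg)).
Qed.

Lemma l2_dot_lincomb (R : realType) (f g h : @spin_space R -> R[i]) (c : R[i]) :
  dot_integrable f g -> dot_integrable f h ->
  dot_integrable f (fun x => c * g x + h x) /\
  l2_dot f (fun x => c * g x + h x) = c * l2_dot f g + l2_dot f h.
Proof.
move=> ifg ifh; case: c => a b.
have Re_mul (z w : R[i]) : complex.Re ((a +i* b)%C * z + w) =
    a * complex.Re z - b * complex.Im z + complex.Re w by case: z w => [? ?] [? ?].
have Im_mul (z w : R[i]) : complex.Im ((a +i* b)%C * z + w) =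
    a * complex.Im z + b * complex.Re z + complex.Im w by case: z w => [? ?] [? ?].
pose re g s r := complex.Re (f (r, s)) * complex.Re (g (r, s)) +
  complex.Im (f (r, s)) * complex.Im (g (r, s)).
pose im g s r := complex.Re (f (r, s)) * complex.Im (g (r, s)) -
  complex.Im (f (r, s)) * complex.Re (g (r, s)).
set k := fun x => _.
have reE s : re k s = fun r => a * re g s r + (- b) * im g s r + re h s r.
  by apply/funext => r; rewrite /re /im /k Re_mul Im_mul; ring.
have imE s : im k s = fun r => a * im g s r + b * re g s r + im h s r.
  by apply/funext => r; rewrite /re /im /k Re_mul Im_mul; ring.
have [re_g im_g] := all_and2 ifg; have [re_h im_h] := all_and2 ifh.
have lin_re s := int3_lincomb a (- b) (re_g s) (im_g s) (re_h s).
have lin_im s := int3_lincomb a b (im_g s) (re_g s) (im_h s).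
split=> [s|].
  split; first by have [] := lin_re s; rewrite -reE.
  by have [] := lin_im s; rewrite -imE.
rewrite /l2_dot -/(re k) -/(im k).
have -> : \sum_(s : bool) int3 (re k s) =
    a * (\sum_(s : bool) int3 (re g s)) - b * (\sum_(s : bool) int3 (im g s)) +
    \sum_(s : bool) int3 (re h s).
  rewrite !mulr_sumr -sumrB -big_split; apply: eq_bigr => s _.
  by have [_] := lin_re s; rewrite -reE => ->; rewrite mulNr.
have -> : \sum_(s : bool) int3 (im k s) =
    a * (\sum_(s : bool) int3 (im g s)) + b * (\sum_(s : bool) int3 (re g s)) +
    \sum_(s : bool) int3 (im h s).
  rewrite !mulr_sumr -!big_split; apply: eq_bigr => s _.
  by have [_] := lin_im s; rewrite -imE => ->.
by [].
Qed.

Lemma l2_dot0 (R : realType) (f : @spin_space R -> R[i]) :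
  dot_integrable f (fun=> 0) /\ l2_dot f (fun=> 0) = 0.
Proof.
have zeroD s : (fun r : R * R * R => complex.Re (f (r, s)) * 0 + complex.Im (f (r, s)) * 0)
    = cst 0 by apply/funext => r; rewrite !mulr0 addr0.
have zeroB s : (fun r : R * R * R => complex.Re (f (r, s)) * 0 - complex.Im (f (r, s)) * 0)
    = cst 0 by apply/funext => r; rewrite !mulr0 subr0.
have int0 : int3 (cst 0 : R * R * R -> R) = 0 by rewrite /int3 Rintegral_cst // mul0r.
split=> [s|].
  by rewrite /= zeroD zeroB; split; exact: integrable0.
rewrite /l2_dot /=; under eq_bigr => s _ do rewrite zeroD int0.
under [X in Complex _ X]eq_bigr => s _ do rewrite zeroB int0.
by rewrite !big1.
Qed.

Lemma orthonormal_linearly_independent (R : realType) n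
    (phi : 'I_n -> @spin_space R -> R[i]) (c : 'I_n -> R[i]) :
  (forall j, H1 (phi j)) -> orthonormal_family phi ->
  (forall x, \sum_j c j * phi j x = 0) -> forall j, c j = 0.
Proof.
move=> H1phi orth sum0 i.
have lin (s : seq 'I_n) :
    dot_integrable (phi i) (fun x => \sum_(j <- s) c j * phi j x) /\
    l2_dot (phi i) (fun x => \sum_(j <- s) c j * phi j x) =
      \sum_(j <- s) c j * l2_dot (phi i) (phi j).
  elim: s => [|j s [int_s dot_s]].
    rewrite big_nil; under eq_fun do rewrite big_nil.
    exact: l2_dot0.
  rewrite big_cons; under eq_fun do rewrite big_cons.
  rewrite -dot_s; apply: l2_dot_lincomb => //.
  exact: H1_dot_integrable.
have [_] := lin (index_enum 'I_n).
under eq_fun do rewrite sum0.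
have [_ ->] := l2_dot0 (phi i).
rewrite (bigD1 i) //= big1 => [|j neq_ji].
  by rewrite orth eqxx mulr1 addr0.
by rewrite orth eq_sym (negPf neq_ji) mulr0.
Qed.

(** Tensor powers of linearly independent functions are linearly independent.
    The indices are fixed one at a time: for points in the other slots held
    fixed, the sum is a linear relation between the phi_j in the next slot. *)
Lemma tensor_eq0 (K : comNzRingType) (X : Type) (x0 : X) N n (phi : 'I_n -> X -> K)
    (C : {ffun 'I_N -> 'I_n} -> K) :
  (forall c : 'I_n -> K, (forall x, \sum_j c j * phi j x = 0) -> forall j, c j = 0) ->
  (forall x : 'I_N -> X, \sum_f C f * \prod_a phi (f a) (x a) = 0) ->
  forall f, C f = 0.
Proof.
move=> indep sum0 f0.
have fixed m : (m <= N)%N -> forall x : 'I_N -> X,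
    \sum_(f : {ffun 'I_N -> 'I_n} | [forall a : 'I_N, (a < m)%N ==> (f a == f0 a)])
      C f * \prod_(a : 'I_N | (m <= a)%N) phi (f a) (x a) = 0.
  elim: m => [_ x|m IHm lt_mN x].
    by rewrite -[RHS](sum0 x); apply: eq_big => [f|f _] //; apply/forallP.
  pose am := Ordinal lt_mN.
  pose coeff j := \sum_(f : {ffun 'I_N -> 'I_n} |
      [forall a : 'I_N, (a < m)%N ==> (f a == f0 a)] && (f am == j))
    C f * \prod_(a : 'I_N | (m < a)%N) phi (f a) (x a).
  transitivity (coeff (f0 am)).
    apply: eq_bigl => f; apply/forallP/andP => [fE|[/forallP fE /eqP fam] a].
      split; last by have := fE am; rewrite /= ltnSn.
      by apply/forallP => a; apply/implyP => lt_am; have := fE a; rewrite ltnS ltnW.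
    rewrite ltnS leq_eqVlt; apply/implyP => /orP[/eqP a_m|lt_am].
      by have -> : a = am by [apply: val_inj]; rewrite fam.
    by have := fE a; rewrite lt_am.
  apply: indep => y.
  rewrite -[RHS](IHm (ltnW lt_mN) (fun a => if a == am then y else x a)).
  rewrite (partition_big (fun f : {ffun 'I_N -> 'I_n} => f am) predT) //=.
  apply: eq_bigr => j _; rewrite mulr_suml; apply: eq_bigr => f /andP[_ /eqP fam].
  rewrite [in RHS](bigD1 am) //= eqxx fam -mulrA [_ * phi j y]mulrC.
  congr (_ * (_ * _)); apply: eq_big => a; first by rewrite ltn_neqAle eq_sym andbC.
  by move=> lt_ma; rewrite ifN // -val_eqE /= gtn_eqF.
rewrite -[RHS](fixed N (leqnn N) (fun=> x0)) (big_pred1 f0) => [|f].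
  by rewrite big1 ?mulr1 // => a; rewrite leqNgt ltn_ord.
apply/forallP/eqP => [fE|-> a]; last by rewrite eqxx implybT.
by apply/ffunP => a; apply/eqP; have := fE a; rewrite ltn_ord.
Qed.

Lemma increasing_pairwise N L (I : {ffun 'I_N -> 'I_L}) :
  increasing I -> pairwise (fun i j : 'I_L => (i < j)%N) (codom I).
Proof.
move=> /forallP incI; rewrite codomE pairwise_map.
apply: (sub_pairwise (r := fun a b : 'I_N => (a < b)%N)).
  by move=> a b /= lt_ab; have /forallP/(_ b)/implyP := incI a; apply.
rewrite -sorted_pairwise; last by move=> j i l; apply: ltn_trans.
by have := iota_ltn_sorted 0 N; rewrite -val_enum_ord sorted_map.
Qed.

Lemma increasing_uniq N L (I : {ffun 'I_N -> 'I_L}) : increasing I -> uniq (codom I).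
Proof.
move=> /increasing_pairwise; rewrite uniq_pairwise; apply: sub_pairwise => i j /=.
by apply: contraTneq => ->; rewrite ltnn.
Qed.

(** Evaluates Slater determinants on unit vectors: if I and J differ, some I a is
    not a value of J, since increasing sequences of the same length with the
    same values agree. *)
Lemma det_incidence (K : comNzRingType) N L (I J : {ffun 'I_N -> 'I_L}) :
  increasing I -> increasing J ->
  \det (\matrix_(a < N, b < N) (I a == J b)%:R) = (I == J)%:R :> K.
Proof.
move=> incI incJ; have uniqI := increasing_uniq incI; have uniqJ := increasing_uniq incJ.
have [<-|neqIJ] := eqVneq I J.
  rewrite -[RHS](det1 K N); congr (\det _); apply/matrixP => a b; rewrite !mxE.
  by rewrite (inj_eq (injectiveP _ uniqI)).
have [/forallP IJ|] := boolP [forall a, I a \in codom J].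
  have subIJ : {subset codom I <= codom J} by move=> _ /codomP[a ->]; apply: IJ.
  have [|_ eq_codom] := uniq_min_size uniqI subIJ; first by rewrite !size_codom.
  have ltT : transitive (fun i j : 'I_L => (i < j)%N).
    by move=> j i l; apply: ltn_trans.
  have /eq_in_map eqIJ : [seq I a | a <- enum 'I_N] = [seq J a | a <- enum 'I_N].
    rewrite -!codomE; apply: (irr_sorted_eq ltT) => // [i||].
    - exact: ltnn.
    - by rewrite (sorted_pairwise ltT) increasing_pairwise.
    - by rewrite (sorted_pairwise ltT) increasing_pairwise.
  by case/eqP: neqIJ; apply/ffunP => a; apply: eqIJ; rewrite mem_enum.
rewrite negb_forall => /existsP[a Ia]; rewrite (expand_det_row _ a) big1 // => b _.
by rewrite mxE; case: eqP Ia => [->|]; rewrite ?codom_f // mul0r.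
Qed.

(** Expanding both sides of the Slater expansion with [det_mulmx_functions] gives
    two tensors that agree on all products phi_(f 0) (x_0) ... phi_(f (N - 1)) (x_(N - 1)),
    hence are equal; evaluate at the increasing f enumerating mu. *)
Lemma occupation_tensorE (R : realType) N L (phi : 'I_L -> @spin_space R -> R[i])
    (psi : 'I_N -> @spin_space R -> R[i]) (U : 'M[R]_(N, L))
    (T : {ffun 'I_L -> bool} -> R) :
  (forall j, H1 (phi j)) -> orthonormal_family phi ->
  (forall i x, psi i x = \sum_(j < L) (U i j)%:C%C * phi j x) ->
  occupation_tensor phi (slater psi) T ->
  forall mu, T mu = occ_det U mu.
Proof.
move=> H1phi orth psiE [T0 slaterE] mu.
have [sz|sz] := eqVneq (size (supp mu)) N; last first.
  by rewrite T0 ?/occ_det ?(negPf sz) // -size_supp; apply/eqP.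
pose t : N.-tuple 'I_L := tcast sz (in_tuple (supp mu)).
have tE : supp mu = t by rewrite val_tcast.
rewrite (occ_det_tuple _ tE).
pose J : {ffun 'I_N -> 'I_L} := [ffun a => tnth t a].
have incJ : increasing J.
  apply/forallP => a; apply/forallP => b; apply/implyP => lt_ab; rewrite !ffunE.
  have /(pairwiseP (tnth t a)) := sorted_supp mu.
  rewrite tE => /(_ a b); rewrite !inE size_tuple -!tnth_nth; apply=> //.
have occJ : occupation J = mu.
  apply/ffunP => j; rewrite ffunE -mem_supp tE.
  apply/codomP/tnthP => -[a ->]; exists a; by rewrite ffunE.
have indep c := @orthonormal_linearly_independent _ _ _ c H1phi orth.
pose UC := map_mx (real_complex R) U.
pose inc (I f : {ffun 'I_N -> 'I_L}) : 'M[R[i]]_N :=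
  \matrix_(a < N, b < N) (I a == f b)%:R.
(* The difference of the two tensors. *)
pose C (f : {ffun 'I_N -> 'I_L}) := \det (colsub f UC) -
  \sum_(I : {ffun 'I_N -> 'I_L} | increasing I)
    (T (occupation I))%:C%C * \det (inc I f).
have x0 : @spin_space R := ((0, 0, 0), true).
have C0 : forall f, C f = 0.
  apply: (tensor_eq0 x0 indep) => x; have := slaterE x; rewrite /slater.
  set Phi : 'M[R[i]]_(L, N) := \matrix_(j, b) phi j (x b).
  have -> : (\matrix_(i < N, j < N) psi i (x j)) = UC *m Phi.
    apply/matrixP => i j; rewrite !mxE psiE; apply: eq_bigr => l _.
    by rewrite !mxE.
  under eq_bigr => I _.
    have -> : (\matrix_(i < N, j < N) phi (I i) (x j)) =
        (\matrix_(a < N, l < L) (I a == l)%:R) *m Phi.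
      apply/matrixP => i j; rewrite !mxE (bigD1 (I i)) //= big1 => [|l neq_l].
        by rewrite !mxE eqxx mul1r addr0.
      by rewrite mxE eq_sym (negPf neq_l) mul0r.
    rewrite mulrCA; over.
  have norm_neq0 : ((Num.sqrt (N`!%:R : R))^-1)%:C%C != 0 :> R[i].
    rewrite -(rmorph0 (real_complex R)) (inj_eq (@complexI R)).
    by rewrite invr_eq0 sqrtr_eq0 -ltNge ltr0n fact_gt0.
  rewrite -mulr_sumr => /(mulfI norm_neq0) detE.
  under eq_bigr => f _ do rewrite mulrBl.
  rewrite sumrB; apply/eqP; rewrite subr_eq0; apply/eqP.
  transitivity (\det (UC *m Phi)).
    rewrite det_mulmx_functions; apply: eq_bigr => f _; rewrite mulrC.
    by congr (_ * _); apply: eq_bigr => a _; rewrite mxE.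
  rewrite detE; under [RHS]eq_bigr => f _ do rewrite mulr_suml.
  rewrite exchange_big; apply: eq_bigr => I _.
  rewrite det_mulmx_functions mulr_sumr; apply: eq_bigr => f _ /=.
  rewrite -mulrA; congr (_ * _); rewrite mulrC; congr (_ * _).
    by congr (\det _); apply/matrixP => a b; rewrite !mxE.
  by apply: eq_bigr => a _; rewrite mxE.
have /eqP := C0 J; rewrite subr_eq0 (bigD1 J) //= big1 => [|I /andP[incI neqIJ]].
  rewrite det_incidence // eqxx mulr1 addr0 occJ => /eqP detJ.
  apply: complexI; rewrite -detJ -det_map_mx; congr (\det _).
  by apply/matrixP => a b; rewrite !mxE ffunE.
by rewrite det_incidence // (negPf neqIJ) mulr0.
Qed.

(** * Singular values of a Slater determinant *)

(* The disjunction (N <= k or N <= L - k), automatic when 2 N <= L, is implicit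
   in the case distinction for p: without it (i.e. when L - N < k < N) the count
   of nonzero singular values is 2^(L-N), as for N = L = 2, k = 1, U = Id.  When
   2 N <= L the guards below are exactly those of the three displayed cases; the
   extra inequalities in the first and third only matter when L < 2 N, where the
   ranges k <= N and L - N <= k overlap and the two formulas differ. *)
Theorem theorem2p1 (R : realType) (N L k : nat)
    (phi : 'I_L -> @spin_space R -> R[i])
    (psi : 'I_N -> @spin_space R -> R[i])
    (U : 'M[R]_(N, L)) (T : {ffun 'I_L -> bool} -> R)
    (hk : (1 <= k)%N) (hkL : (k < L)%N) :
  (0 < N)%N ->
  (forall j, H1 (phi j)) ->
  orthonormal_family phi ->
  orthonormal_family psi ->
  (forall i x, psi i x = \sum_(j < L) (U i j)%:C%C * phi j x) ->
  U *m U^T = 1%:M ->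
  occupation_tensor phi (slater psi) T ->
  let V := first_cols (ltnW hkL) U in
  let W := last_cols (ltnW hkL) U in
  full_rank V ->
  full_rank W ->
  (N <= k)%N \/ (N <= L - k)%N ->
  let sigma := nonzero_singular_values (reshape_tensor (ltnW hkL) T) in
  let d := minn (2 ^ k) (minn (2 ^ N) (2 ^ (L - k))) in
  size sigma = d /\
  exists p : R,
    [/\ forall j : nat, (1 <= j <= d)%N ->
          sigma`_(j - 1) ^+ 2 * sigma`_(d - j) ^+ 2 = p,
        (k <= N)%N -> (N <= L - k)%N ->
          p = \det (V^T *m V) * \det (W *m W^T),
        (N <= k <= L - N)%N ->
          p = \det (V *m V^T) * \det (W *m W^T)
      & (L - N <= k <= L - 1)%N -> (N <= k)%N ->
          p = \det (V *m V^T) * \det (W^T *m W)].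
Proof.
move=> _ H1phi orth _ psiE UU1 occT V W rankV rankW N_small.
have TE := occupation_tensorE H1phi orth psiE occT.
have [size_s [p [pair_p p1 p2 p3]]] :=
  reshape_singular_values UU1 TE rankV rankW N_small.
split=> //; exists p; split=> //.
  by move=> /andP[le_Nk le_kLN]; apply: p2; lia.
by move=> /andP[le_LNk _] le_Nk; apply: p3; lia.
Qed.
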